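(* Let $\bm{H}_1,\dots,\bm{H}_N$ be random matrices with values in $\mathbb{C}^{N_R\times N_T}$ (sub-channels of a frequency-selective MIMO channel), let $\bm{\mathcal{H}}=\operatorname{diag}(\bm{H}_1,\dots,\bm{H}_N)$ be the block diagonal matrix, let $\lambda^i_{\max}$ be the maximum eigenvalue of $\bm{H}_i\bm{H}_i^\ast$ and $\lambda_{\max}$ the maximum eigenvalue of $\bm{\mathcal{H}}\bm{\mathcal{H}}^\ast$. Let $W,\rho>0$. Consider the capacity with channel side information known at the transmitter $$c=\frac{W}{N}\max_{\bm{R}\succeq 0,\ \operatorname{Tr}[\bm{R}]=N_TN}\log_2\det\Big(\bm{I}_{N_RN}+\frac{\rho}{N_T}\bm{\mathcal{H}}\bm{R}\bm{\mathcal{H}}^\ast\Big)$$ (maximum over Hermitian positive semidefinite $\bm{R}$ of size $N_TN$), and the capacity with channel side information unknown at the transmitter $$c=\frac{W}{N}\sum_{i=1}^N\log_2\det\Big(\bm{I}_{N_R}+\frac{\rho}{N_T}\bm{H}_i\bm{H}_i^\ast\Big).$$ The condition ''for every $i\in\{1,\dots,N\}$, $\mathbb{E}[(1+\lambda^i_{\max})^\theta]<\infty$ for some $\theta>0$'' is equivalent to the condition ''$\mathbb{E}[(1+\lambda_{\max})^\theta]<\infty$ for some $\theta>0$'', and if it holds then the distribution of the capacity (in either case) is light-tailed.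
   Context: A nonnegative random variable $X$ is light-tailed if $\Pr(X>x)=O(e^{-\theta x})$ for some $\theta>0$, equivalently $\mathbb{E}[e^{\theta X}]<\infty$ for some $\theta>0$. $W$ is the bandwidth, $N$ the number of sub-channels, $\rho=P/(N_0W)$. *)

(* Defs.v *)
From HB Require Import structures.
From mathcomp Require Import all_boot all_order all_algebra.
From mathcomp Require Import all_classical all_reals all_analysis.
From mathcomp Require Import complex.
Set Implicit Arguments. Unset Strict Implicit. Unset Printing Implicit Defensive.
Import Order.TTheory GRing.Theory Num.Theory.
Local Open Scope ring_scope.
Local Open Scope classical_set_scope.

Section Defs.
Variable R : realType.
Local Notation C := (complex R).

Definition ctr m n (A : 'M[C]_(m, n)) : 'M[C]_(n, m) :=
  (map_mx (@conjc R) A)^T.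

Definition psd n (A : 'M[C]_n) : Prop :=
  ctr A = A /\ forall v : 'cV[C]_n, 0 <= complex.Re ((ctr v *m A *m v) 0 0).

Definition lambda_max n (A : 'M[C]_n) : R :=
  sup [set r : R | eigenvalue A (r%:C)%C].

Definition log2 (x : R) : R := ln x / ln 2.

Definition blkdiag N NR NT (H : 'I_N -> 'M[C]_(NR, NT)) :
  'M[C]_(\sum_(i < N) NR, \sum_(i < N) NT) :=
  \mxblock_(i < N, j < N) (if i == j then H i else 0).

Definition cap_known (W rho : R) N NR NT (H : 'I_N -> 'M[C]_(NR, NT)) : R :=
  let HH := blkdiag H in
  W / N%:R * sup [set y : R | exists Rm : 'M[C]_(\sum_(i < N) NT),
     [/\ psd Rm, \tr Rm = (NT * N)%:R &
       y = log2 (complex.Re (\det (1%:M + ((rho / NT%:R)%:C)%C *: (HH *m Rm *m ctr HH))))]].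

Definition cap_unknown (W rho : R) N NR NT (H : 'I_N -> 'M[C]_(NR, NT)) : R :=
  W / N%:R * \sum_(i < N)
    log2 (complex.Re (\det (1%:M + ((rho / NT%:R)%:C)%C *: (H i *m ctr (H i))))).

End Defs.

Definition light_tailed d (T : measurableType d) (R : realType)
  (P : probability T R) (X : T -> R) : Prop :=
  exists theta : R, (0 < theta)%R /\ exists K : R, exists x0 : R,
    forall x : R, (x0 <= x)%R ->
      (P [set t | (x < X t)%R] <= (K * expR (- (theta * x)))%:E)%E.

Definition finite_moment d (T : measurableType d) (R : realType)
  (P : probability T R) (Y : T -> R) : Prop :=
  exists theta : R, (0 < theta)%R /\
    (\int[P]_t ((1 + Y t) `^ theta)%:E < +oo)%E.

(* Main.v *)
(* The squared Frobenius norm s(H) = tr(H H^* ) is a measurable substitute for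
   the largest eigenvalue: lambda_max <= s <= n lambda_max, so each of the two
   moment conditions is equivalent to the same condition on s, and s is additive
   over diagonal blocks.  After diagonalizing a positive semidefinite M one reads
   off 1 <= det(1 + c M) <= (1 + c tr M)^n, and tr(H R H^* ) <= tr R * s(H), so
   both capacities are at most a ln(1 + k s) for constants a and k.  Markov's
   inequality for (1 + k s)^theta then yields the exponential tail.  The capacity
   known at the transmitter is measurable because its supremum may be restricted
   to countably many covariance matrices. *)
Require Import Defs.
From HB Require Import structures.
From mathcomp Require Import all_boot all_order all_algebra.
From mathcomp Require Import all_classical all_reals all_analysis.
From mathcomp Require Import measurable_realfun complex ring.
Import Order.TTheory GRing.Theory Num.Theory.
Local Open Scope ring_scope.
Local Open Scope classical_set_scope.
Set Implicit Arguments.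
Unset Strict Implicit.
Unset Printing Implicit Defensive.
Import numFieldNormedType.Exports.

(** * Positive semidefinite complex matrices *)

Section ConjugateTranspose.
Variable R : realType.
Local Notation C := (complex R).
Implicit Types m n p : nat.

Lemma ctrE m n (A : 'M[C]_(m, n)) i j : ctr A i j = conjc (A j i).
Proof. by rewrite !mxE. Qed.

Lemma ctrM m n p (A : 'M[C]_(m, n)) (B : 'M[C]_(n, p)) :
  ctr (A *m B) = ctr B *m ctr A.
Proof. by rewrite /ctr map_mxM trmx_mul. Qed.

Lemma ctrK m n (A : 'M[C]_(m, n)) : ctr (ctr A) = A.
Proof. by apply/matrixP => i j; rewrite !ctrE conjcK. Qed.

Lemma ctr1 n : ctr (1%:M : 'M[C]_n) = 1%:M.
Proof. by rewrite /ctr map_mx1 trmx1. Qed.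

Lemma trctr m n (A : 'M[C]_(m, n)) : map_mx Num.conj A^T = ctr A.
Proof. by apply/matrixP => i j; rewrite !mxE. Qed.

(** Squared Frobenius norm in real coordinates, so that it takes values in [R] and is visibly
    nonnegative. *)
Definition sqnorm m n (A : 'M[C]_(m, n)) : R :=
  \sum_i \sum_j (complex.Re (A i j) ^+ 2 + complex.Im (A i j) ^+ 2).

Lemma sqnorm_ge0 m n (A : 'M[C]_(m, n)) : 0 <= sqnorm A.
Proof.
by do 2 (apply: sumr_ge0 => ? _); rewrite addr_ge0 ?sqr_ge0.
Qed.

Lemma mulcJ (z : C) :
  z * conjc z = ((complex.Re z ^+ 2 + complex.Im z ^+ 2)%:C)%C.
Proof.
case: z => a b /=; apply/eqP; rewrite eq_complex /= mulrN opprK !expr2.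
by rewrite eqxx mulrN mulrC addNr eqxx.
Qed.

Lemma mxtrace_mulctr m n (A : 'M[C]_(m, n)) :
  \tr (A *m ctr A) = ((sqnorm A)%:C)%C.
Proof.
rewrite /mxtrace /sqnorm rmorph_sum; apply: eq_bigr => i _.
rewrite mxE rmorph_sum; apply: eq_bigr => j _.
by rewrite ctrE mulcJ.
Qed.

Lemma sqnorm_unitary m n (A : 'M[C]_(m, n)) (U : 'M[C]_n) :
  U *m ctr U = 1%:M -> sqnorm (A *m U) = sqnorm A.
Proof.
move=> UU; have := mxtrace_mulctr (A *m U).
by rewrite ctrM mulmxA -(mulmxA A) UU mulmx1 mxtrace_mulctr => -[].
Qed.

Lemma psd_mulctr m n (A : 'M[C]_(m, n)) (M : 'M[C]_n) :
  psd M -> psd (A *m M *m ctr A).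
Proof.
move=> [MH Mge0]; split; first by rewrite !ctrM ctrK MH mulmxA.
by move=> v; have := Mge0 (ctr A *m v); rewrite ctrM ctrK !mulmxA.
Qed.

Lemma psd1 n : psd (1%:M : 'M[C]_n).
Proof.
split=> [|v]; first exact: ctr1.
rewrite mulmx1 mxE raddf_sum; apply: sumr_ge0 => i _.
by rewrite ctrE mulrC mulcJ /= addr_ge0 ?sqr_ge0.
Qed.

Lemma psd_gram m n (A : 'M[C]_(m, n)) : psd (A *m ctr A).
Proof. by have := psd_mulctr A (psd1 n); rewrite mulmx1. Qed.

Lemma mul_row_col m n p (A : 'M[C]_(m, n)) (B : 'M[C]_(n, p)) i j :
  (row i A *m col j B) 0 0 = (A *m B) i j.
Proof. by rewrite !mxE; apply: eq_bigr => k _; rewrite !mxE. Qed.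

Definition diagc n (d : 'I_n -> R) : 'M[C]_n := diag_mx (\row_i ((d i)%:C)%C).

(** The spectral theorem for Hermitian matrices, with the eigenvalues, which are real, recorded in
    [R]. *)
Lemma psd_spectral n (M : 'M[C]_n) : psd M ->
  exists (U : 'M[C]_n) (d : 'I_n -> R),
    [/\ U *m ctr U = 1%:M, ctr U *m U = 1%:M,
        M = ctr U *m diagc d *m U & forall i, 0 <= d i].
Proof.
move=> [MH Mge0].
have Mh : M \is hermsymmx.
  by rewrite is_hermitianmxE expr0 scale1r trctr MH.
set U := spectralmx M.
have Uu : U \is unitarymx by exact: spectral_unitarymx.
have UU : U *m ctr U = 1%:M by rewrite -trctr; apply/unitarymxP.
have UU' : ctr U *m U = 1%:M by apply/mulmx1C.
exists U, (fun i => complex.Re (spectral_diag M 0 i)).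
have Mdiag : M = ctr U *m
    diagc (fun i => complex.Re (spectral_diag M 0 i)) *m U.
  have /hermitian_normalmx /orthomx_spectralP := Mh.
  rewrite (invmx_unitary Uu) trctr => Mspec; rewrite [LHS]Mspec.
  congr (_ *m diag_mx _ *m _).
  apply/rowP => i; rewrite mxE RRe_real //.
  by have /mxOverP := hermitian_spectral_diag_real Mh; apply.
(* The quadratic form of [M] at the conjugate transpose of row [i] of [U] equals [d i]. *)
split=> // i; have := Mge0 (ctr (row i U)); rewrite ctrK.
have -> : row i U *m M = row i (U *m M) by rewrite row_mul.
have -> : ctr (row i U) = col i (ctr U).
  by apply/matrixP => a b; rewrite !mxE.
rewrite {1}Mdiag !mulmxA UU mul1mx mul_row_col -mulmxA UU mulmx1.
by rewrite !mxE eqxx.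
Qed.

Section Diagonalized.
Variables (n : nat) (M U : 'M[C]_n) (d : 'I_n -> R).
Hypotheses (UU : U *m ctr U = 1%:M) (UU' : ctr U *m U = 1%:M).
Hypothesis ME : M = ctr U *m diagc d *m U.

Lemma mxtrace_diagonalized : \tr M = ((\sum_i d i)%:C)%C.
Proof.
rewrite ME mxtrace_mulC mulmxA UU mul1mx mxtrace_diag rmorph_sum.
by apply: eq_bigr => i _; rewrite mxE.
Qed.

(** The same [U] diagonalizes [1 + c M], and the determinants of [ctr U] and [U] multiply to [1]. *)
Lemma det1D_diagonalized (c : R) :
  \det (1%:M + (c%:C)%C *: M) = ((\prod_i (1 + c * d i))%:C)%C.
Proof.
have -> : 1%:M + (c%:C)%C *: M = ctr U *m diagc (fun i => 1 + c * d i) *m U.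
  have -> : diagc (fun i => 1 + c * d i) = 1%:M + (c%:C)%C *: diagc d.
    apply/matrixP => i j; rewrite !mxE rmorphD rmorphM rmorph1 /=.
    by case: eqP => _; rewrite ?mulr1n // !mulr0n mulr0 addr0.
  by rewrite mulmxDr mulmxDl mulmx1 UU' -scalemxAr -scalemxAl -ME.
rewrite !det_mulmx mulrAC -det_mulmx UU' det1 mul1r det_diag rmorph_prod.
by apply: eq_bigr => i _; rewrite mxE.
Qed.

(** Eigenvectors are row vectors here. Row [i] of [U] is one for [d i], and it is nonzero because
    multiplying it by [ctr U] gives row [i] of the identity. *)
Lemma eigenvalue_diagonalized i : eigenvalue M ((d i)%:C)%C.
Proof.
apply/eigenvalueP; exists (row i U).
  rewrite ME !mulmxA -!row_mul UU mul1mx; apply/rowP => j.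
  by rewrite mxE mul_diag_mx !mxE.
apply/eqP => U0.
have := row_mul i U (ctr U).
rewrite U0 mul0mx UU => /rowP /(_ i)/eqP; rewrite !mxE eqxx.
by rewrite pnatr_eq0.
Qed.

Lemma eigenvalue_diagonalizedP r : eigenvalue M ((r)%:C)%C -> exists i, r = d i.
Proof.
move=> /eigenvalueP[v vM v0]; pose w := v *m ctr U.
have w0 : w != 0.
  apply: contraNneq v0 => w0.
  by rewrite -(mulmx1 v) -UU' mulmxA -/w w0 mul0mx eqxx.
have wD : w *m diagc d = (r%:C)%C *: w.
  by rewrite /w scalemxAl -vM ME !mulmxA -[RHS]mulmxA UU mulmx1.
(* In the eigenbasis [w] is an eigenvector of a diagonal matrix, so any nonzero coordinate [i]
   forces [r = d i]. *)
have [i wi] : exists i, w 0 i != 0.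
  apply/existsP; apply: contraNT w0 => /existsPn w0.
  by apply/eqP/rowP => i; rewrite [RHS]mxE; apply/eqP/negPn/w0.
exists i; have /rowP /(_ i) := wD.
rewrite mul_mx_diag [LHS]mxE [RHS]mxE [X in _ * X]mxE mulrC.
by move=> /(mulIf wi)[].
Qed.

End Diagonalized.

(** The trace is the sum of the nonnegative eigenvalues [d i], so it lies between the largest of
    them and [n] times the largest. *)
Lemma psd_lambda_max n (M : 'M[C]_n) : psd M ->
  0 <= lambda_max M <= complex.Re (\tr M) /\
  complex.Re (\tr M) <= n%:R * lambda_max M.
Proof.
move=> /psd_spectral[U [d [UU UU' ME d0]]].
have trE : complex.Re (\tr M) = \sum_i d i.
  by rewrite (mxtrace_diagonalized UU ME).
rewrite trE; pose E := [set r : R | eigenvalue M (r%:C)%C].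
have Eub : ubound E (\sum_i d i).
  move=> r /(eigenvalue_diagonalizedP UU UU' ME)[i ->].
  by rewrite (bigD1 i) //= lerDl sumr_ge0.
have dle i : d i <= lambda_max M.
  apply: ub_le_sup; first by exists (\sum_i d i).
  exact: eigenvalue_diagonalized UU ME i.
split; last first.
  have -> : n%:R * lambda_max M = \sum_(i < n) lambda_max M.
    by rewrite sumr_const card_ord mulr_natl.
  exact: ler_sum.
(* An empty spectrum occurs for [n = 0]; then [lambda_max] is the default value [0] of [sup]. *)
have [[r Er]|/set0P/negP/negPn/eqP E0] := pselect (E !=set0).
  apply/andP; split; last by apply: ge_sup => //; exists r.
  have [i _] := eigenvalue_diagonalizedP UU UU' ME Er.
  exact: le_trans (d0 i) (dle i).
by rewrite /lambda_max -/E E0 sup0 lexx sumr_ge0.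
Qed.

Lemma lambda_max_gram m n (A : 'M[C]_(m, n)) :
  0 <= lambda_max (A *m ctr A) <= sqnorm A /\
  sqnorm A <= m%:R * lambda_max (A *m ctr A).
Proof. by have := psd_lambda_max (psd_gram A); rewrite mxtrace_mulctr. Qed.

(** The determinant is the product of the [1 + c * d i], and each [d i] lies between [0] and the
    trace. *)
Lemma psd_det1D n (M : 'M[C]_n) (c : R) : psd M -> 0 <= c ->
  1 <= complex.Re (\det (1%:M + (c%:C)%C *: M))
    <= (1 + c * complex.Re (\tr M)) ^+ n.
Proof.
move=> /psd_spectral[U [d [UU UU' ME d0]]] c0.
rewrite (mxtrace_diagonalized UU ME) (det1D_diagonalized UU' ME) /=.
have cd i : 1 <= 1 + c * d i by rewrite lerDl mulr_ge0.
apply/andP; split.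
  have {1}-> : 1 = \prod_(i < n) 1 :> R by rewrite big1.
  by apply: ler_prod => i _; rewrite ler01 cd.
have -> : (1 + c * (\sum_i d i)) ^+ n = \prod_(i < n) (1 + c * (\sum_i d i)).
  by rewrite prodr_const card_ord.
apply: ler_prod => i _; rewrite (le_trans ler01 (cd i)) lerD2l ler_wpM2l //.
by rewrite (bigD1 i) //= lerDl sumr_ge0.
Qed.

(** With [B = A *m ctr U] the trace becomes the sum of [d j] times the squared modulus of [B i j].
    Each [d j] is at most the trace of [M], and [B] has the same Frobenius norm as [A]. *)
Lemma psd_mxtrace_mulctr m n (A : 'M[C]_(m, n)) (M : 'M[C]_n) : psd M ->
  0 <= complex.Re (\tr (A *m M *m ctr A)) <= complex.Re (\tr M) * sqnorm A.
Proof.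
move=> /psd_spectral[U [d [UU UU' ME d0]]].
rewrite (mxtrace_diagonalized UU ME) /=.
have -> : sqnorm A = sqnorm (A *m ctr U) by rewrite sqnorm_unitary // ctrK.
have -> : complex.Re (\tr (A *m M *m ctr A)) =
    \sum_i \sum_j d j * (complex.Re ((A *m ctr U) i j) ^+ 2 +
                         complex.Im ((A *m ctr U) i j) ^+ 2).
  rewrite {1}ME; set B := A *m ctr U.
  have -> : A *m (ctr U *m diagc d *m U) *m ctr A = B *m diagc d *m ctr B.
    by rewrite /B ctrM ctrK !mulmxA.
  rewrite /mxtrace raddf_sum; apply: eq_bigr => i _ /=.
  rewrite mxE raddf_sum; apply: eq_bigr => j _ /=.
  by rewrite mul_mx_diag !mxE mulrAC mulcJ -rmorphM /= mulrC.
apply/andP; split.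
  by do 2 (apply: sumr_ge0 => ? _); rewrite mulr_ge0 // addr_ge0 ?sqr_ge0.
rewrite /sqnorm mulr_sumr; apply: ler_sum => i _.
rewrite mulr_sumr; apply: ler_sum => j _.
rewrite ler_wpM2r ?addr_ge0 ?sqr_ge0 //.
by rewrite (bigD1 j) //= lerDl sumr_ge0.
Qed.

Lemma sqnorm_blkdiag N NR NT (H : 'I_N -> 'M[C]_(NR, NT)) :
  sqnorm (blkdiag H) = \sum_i sqnorm (H i).
Proof.
apply: complexI; rewrite -mxtrace_mulctr rmorph_sum /=.
have -> : ctr (blkdiag H) =
    \mxblock_(i < N, j < N) ctr (if j == i then H j else 0).
  by rewrite -tr_mxblock; apply/matrixP => i j; rewrite !mxE.
rewrite /blkdiag mul_mxblock mxtrace_mxblock.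
apply: eq_bigr => i _; rewrite -mxtrace_mulctr (bigD1 i) //= eqxx big1.
  by rewrite addr0.
by move=> j /negPf; rewrite eq_sym => ->; rewrite mul0mx.
Qed.

End ConjugateTranspose.

(** * Polynomial functions of matrix entries *)

(* [S] is instantiated both with the measurable and with the continuous
   functions. *)
Section RegularMatrixFunctions.
Variables (R : realType) (X : Type) (S : (X -> R) -> Prop).
Local Notation C := (complex R).
Hypothesis S_cst : forall a : R, S (fun=> a).
Hypothesis S_add : forall f g, S f -> S g -> S (fun x => f x + g x).
Hypothesis S_mul : forall f g, S f -> S g -> S (fun x => f x * g x).

Definition regc (f : X -> C) :=
  S (fun x => complex.Re (f x)) /\ S (fun x => complex.Im (f x)).

Definition regmx m n (A : X -> 'M[C]_(m, n)) :=
  forall i j, regc (fun x => A x i j).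

Lemma regc_cst (a : C) : regc (fun=> a).
Proof. by split; exact: S_cst. Qed.

Lemma regc_add f g : regc f -> regc g -> regc (fun x => f x + g x).
Proof.
move=> [fR fI] [gR gI]; split.
  by under eq_fun do rewrite raddfD /=; exact: S_add.
by under eq_fun do rewrite raddfD /=; exact: S_add.
Qed.

Lemma S_opp f : S f -> S (fun x => - f x).
Proof. by move=> Sf; under eq_fun do rewrite -mulN1r; exact: S_mul. Qed.

Lemma regc_mul f g : regc f -> regc g -> regc (fun x => f x * g x).
Proof.
move=> [fR fI] [gR gI].
have mulE x : f x * g x =
    ((complex.Re (f x) * complex.Re (g x) - complex.Im (f x) * complex.Im (g x)) +i*
     (complex.Re (f x) * complex.Im (g x) + complex.Im (f x) * complex.Re (g x)))%C.
  by case: (f x) => a b; case: (g x).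
split; under eq_fun do rewrite mulE /=.
  by apply: S_add; [exact: S_mul | apply: S_opp; exact: S_mul].
by apply: S_add; exact: S_mul.
Qed.

Lemma regc_conj f : regc f -> regc (fun x => conjc (f x)).
Proof.
move=> [fR fI]; split.
  by rewrite (_ : (fun x => _) = fun x => complex.Re (f x)) //;
     apply/funext => x; case: (f x).
rewrite (_ : (fun x => _) = fun x => - complex.Im (f x)); first exact: S_opp.
by apply/funext => x; case: (f x).
Qed.

Lemma regc_sum (I : Type) (r : seq I) (P : pred I) (f : I -> X -> C) :
  (forall i, regc (f i)) -> regc (fun x => \sum_(i <- r | P i) f i x).
Proof.
move=> fS; elim: r => [|i r IH].
  by under eq_fun do rewrite big_nil; exact: regc_cst.
under eq_fun do rewrite big_cons; case: (P i) => //.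
exact: regc_add.
Qed.

Lemma regc_prod (I : Type) (r : seq I) (f : I -> X -> C) :
  (forall i, regc (f i)) -> regc (fun x => \prod_(i <- r) f i x).
Proof.
move=> fS; elim: r => [|i r IH].
  by under eq_fun do rewrite big_nil; exact: regc_cst.
by under eq_fun do rewrite big_cons; exact: regc_mul.
Qed.

Lemma regmx_cst m n (A : 'M[C]_(m, n)) : regmx (fun=> A).
Proof. by move=> i j; exact: regc_cst. Qed.

Lemma regmx_add m n (A B : X -> 'M[C]_(m, n)) :
  regmx A -> regmx B -> regmx (fun x => A x + B x).
Proof. by move=> SA SB i j; under eq_fun do rewrite mxE; exact: regc_add. Qed.

Lemma regmx_scale m n (a : C) (A : X -> 'M[C]_(m, n)) :
  regmx A -> regmx (fun x => a *: A x).
Proof.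
move=> SA i j; under eq_fun do rewrite mxE.
by apply: regc_mul => //; exact: regc_cst.
Qed.

Lemma regmx_mul m n p (A : X -> 'M[C]_(m, n)) (B : X -> 'M[C]_(n, p)) :
  regmx A -> regmx B -> regmx (fun x => A x *m B x).
Proof.
move=> SA SB i j; under eq_fun do rewrite mxE.
by apply: regc_sum => k; exact: regc_mul.
Qed.

Lemma regmx_ctr m n (A : X -> 'M[C]_(m, n)) :
  regmx A -> regmx (fun x => ctr (A x)).
Proof. by move=> SA i j; under eq_fun do rewrite ctrE; exact: regc_conj. Qed.

Lemma regmx_blkdiag N NR NT (H : 'I_N -> X -> 'M[C]_(NR, NT)) :
  (forall i, regmx (H i)) -> regmx (fun x => blkdiag (H ^~ x)).
Proof.
move=> SH i j; rewrite /blkdiag; under eq_fun do rewrite mxE.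
case: (tagnat.sig1 i == tagnat.sig1 j); first exact: SH.
by under eq_fun do rewrite mxE; exact: regc_cst.
Qed.

(** By the Leibniz formula the determinant is a polynomial in the entries. *)
Lemma regc_det n (A : X -> 'M[C]_n) : regmx A -> regc (fun x => \det (A x)).
Proof.
move=> SA; rewrite /determinant; apply: regc_sum => s.
by apply: regc_mul; [exact: regc_cst | apply: regc_prod => i; exact: SA].
Qed.

Lemma reg_sqnorm m n (A : X -> 'M[C]_(m, n)) :
  regmx A -> S (fun x => sqnorm (A x)).
Proof.
move=> SA.
have [+ _] : regc (fun x => \tr (A x *m ctr (A x))).
  by apply: regc_sum => i; apply: regmx_mul => //; exact: regmx_ctr.
by under eq_fun do rewrite mxtrace_mulctr.
Qed.

End RegularMatrixFunctions.

(** * Countable dense subsets of sets of real matrices *)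

Section CountableDense.
Variable R : realType.

Lemma ball_ratr_mx m n (x : 'M[R]_(m, n)) (e : R) : 0 < e ->
  exists q : 'M[rat]_(m, n), ball (map_mx ratr q : 'M[R]_(m, n)) e x.
Proof.
move=> e0.
have qP i j : exists r : rat, `|ratr r - x i j| < e.
  have /rat_in_itvoo[r] : x i j < x i j + e by rewrite ltrDl.
  rewrite in_itv /= => /andP[r1 r2]; exists r.
  by rewrite ger0_norm ?subr_ge0 1?ltW // ltrBlDl.
exists (\matrix_(i, j) projT1 (cid (qP i j))).
by split=> // i j; rewrite !mxE; exact: (projT2 (cid (qP i j))).
Qed.

(** Since [D] may contain no rational matrix, one point of [D] is chosen in each ball with rational
    centre and radius [1 / (k + 1)] that meets [D]; [x0] fills the other indices. *)
Lemma countable_dense_subset m n (D : set 'M[R]_(m, n)) : D !=set0 ->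
  exists u : nat -> 'M[R]_(m, n), (forall k, D (u k)) /\
    forall x O, D x -> nbhs x O -> exists k, O (u k).
Proof.
move=> [x0 Dx0].
pose near q x := D x /\ ball (map_mx ratr q.1 : 'M[R]_(m, n)) (q.2.+1%:R^-1) x.
pose g (q : 'M[rat]_(m, n) * nat) :=
  if pselect (exists x, near q x) is left h then projT1 (cid h) else x0.
pose u k := if unpickle k is Some q then g q else x0.
have Dg q : D (g q).
  by rewrite /g; case: pselect => // h; have [] := projT2 (cid h).
exists u; split=> [k|x O Dx /nbhs_ballP[e /= e0 eO]].
  by rewrite /u; case: unpickle.
(* Radius below [e / 2]: the chosen point and [x] share a rational ball, hence are within [e] of
   each other. *)
have [k ke] : exists k, k.+1%:R^-1 < e / 2.
  have e20 : 0 < e / 2 by rewrite divr_gt0.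
  have [k _ /(_ k (leqnn k))] := near_infty_natSinv_lt (PosNum e20).
  by exists k.
have k0 : 0 < k.+1%:R^-1 :> R by rewrite invr_gt0.
have [q qx] := ball_ratr_mx x k0.
exists (pickle (q, k)); rewrite /u pickleK; apply: eO.
rewrite /g; case: pselect => [h|[]]; last by exists x.
have [_ /= qy] := projT2 (cid h).
by apply: ball_splitr (le_ball _ qx) (le_ball _ qy); exact: ltW.
Qed.

End CountableDense.

(** * Moments and tails *)

Section MomentsAndTails.
Context d (T : measurableType d) (R : realType) (P : probability T R).
Implicit Types f g : T -> R.

(* Unlike [ge0_le_integral], no measurability is required; [lambda_max] is never
   shown to be measurable. *)
Lemma ge0_le_integral_setT (f g : T -> \bar R) :
  (forall t, 0 <= f t)%E -> (forall t, f t <= g t)%E ->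
  (\int[P]_t f t <= \int[P]_t g t)%E.
Proof.
move=> f0 fg; have g0 t : (0 <= g t)%E by exact: le_trans (f0 t) (fg t).
(* The integral is a supremum over the simple functions below the integrand, and those below [f] are
   also below [g]. *)
rewrite !ge0_integralTE //; apply: ereal_sup_le => _ [h /= hf <-].
by exists h => //= t; exact: le_trans (hf t) (fg t).
Qed.

Lemma le_finite_moment f g : (forall t, 0 <= f t <= g t) ->
  finite_moment P g -> finite_moment P f.
Proof.
move=> fg [theta [theta0 gfin]]; exists theta; split; first exact: theta0.
apply: le_lt_trans gfin; apply: ge0_le_integral_setT => t.
  by rewrite lee_fin powR_ge0.
have /andP[f0 fgt] := fg t.
by rewrite lee_fin ge0_ler_powR ?nnegrE ?(ltW theta0) ?addr_ge0 ?lerD2l //;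
   exact: le_trans fgt.
Qed.

Lemma measurable_moment f theta : measurable_fun setT f ->
  measurable_fun setT (fun t => ((1 + f t) `^ theta)%:E).
Proof.
move=> mf; apply/measurable_EFinP.
apply: (measurableT_comp (measurable_powR theta)).
exact: measurable_funD.
Qed.

(** The same exponent works because [1 + k * f <= (1 + k) * (1 + f)]. *)
Lemma finite_momentZ f k : measurable_fun setT f -> (forall t, 0 <= f t) ->
  0 <= k -> finite_moment P f -> finite_moment P (fun t => k * f t).
Proof.
move=> mf f0 k0 [theta [theta0 ffin]]; exists theta; split; first exact: theta0.
apply: (@le_lt_trans _ _
  (\int[P]_t (((1 + k) `^ theta)%:E * ((1 + f t) `^ theta)%:E))%E).
  apply: ge0_le_integral_setT => t; first by rewrite lee_fin powR_ge0.
  rewrite -EFinM lee_fin -powRM ?addr_ge0 //.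
  rewrite ge0_ler_powR ?nnegrE ?(ltW theta0) ?mulr_ge0 ?addr_ge0 ?mulr_ge0 //.
  have -> : (1 + k) * (1 + f t) = 1 + k * f t + (k + f t) by ring.
  by rewrite lerDl addr_ge0.
rewrite ge0_integralZl_EFin ?powR_ge0 //.
- by rewrite lte_mul_pinfty ?lee_fin ?powR_ge0.
- by move=> t _; rewrite lee_fin powR_ge0.
- exact: measurable_moment.
Qed.

(** Only [f] has to be measurable: [k^-1 * f] lies below [g], and the scaling by [k] is then applied
    to [f] alone. This lets [g] be a largest eigenvalue. *)
Lemma finite_moment_dominated f g k : measurable_fun setT f ->
  0 < k -> (forall t, 0 <= f t <= k * g t) ->
  finite_moment P g -> finite_moment P f.
Proof.
move=> mf k0 fg gfin; have f0 t : 0 <= f t by have /andP[] := fg t.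
have -> : f = fun t => k * (k^-1 * f t).
  by apply/funext => t; rewrite mulVKf ?gt_eqF.
apply: finite_momentZ.
- exact: measurable_funM.
- by move=> t; rewrite mulr_ge0 // invr_ge0 ltW.
- exact: ltW.
apply: le_finite_moment gfin => t; have /andP[_ fgt] := fg t.
by rewrite mulr_ge0 ?invr_ge0 ?(ltW k0) //= ler_pdivrMl.
Qed.

(** The sum is at most twice the maximum [h]. As the bases are at least [1], lowering the exponent
    to the minimum of [a] and [b] keeps the power of [1 + h] below one of the two given
    integrands. *)
Lemma finite_momentD f g : measurable_fun setT f -> measurable_fun setT g ->
  (forall t, 0 <= f t) -> (forall t, 0 <= g t) ->
  finite_moment P f -> finite_moment P g ->
  finite_moment P (fun t => f t + g t).
Proof.
move=> mf mg f0 g0 [a [a0 ffin]] [b [b0 gfin]].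
pose h t := Num.max (f t) (g t).
have h0 t : 0 <= h t by rewrite le_max f0.
apply: (@le_finite_moment _ (fun t => 2 * h t)) => [t|].
  by rewrite addr_ge0 //= mulr_natl mulr2n lerD // le_max lexx ?orbT.
apply: finite_momentZ => //; first exact: measurable_maxr.
exists (Num.min a b); split; first by rewrite lt_min a0 b0.
apply: (@le_lt_trans _ _
  (\int[P]_t (((1 + f t) `^ a)%:E + ((1 + g t) `^ b)%:E))%E).
  apply: ge0_le_integral_setT => t; first by rewrite lee_fin powR_ge0.
  rewrite -EFinD lee_fin /h; case: (leP (f t) (g t)) => _.
    apply: (@le_trans _ _ ((1 + g t) `^ b)); last by rewrite lerDr powR_ge0.
    by rewrite ler_powR ?lerDl // ge_min lexx orbT.
  apply: (@le_trans _ _ ((1 + f t) `^ a)); last by rewrite lerDl powR_ge0.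
  by rewrite ler_powR ?lerDl // ge_min lexx.
have p0 (F : T -> R) (c : R) t : setT t -> (0 <= ((1 + F t) `^ c)%:E)%E.
  by rewrite lee_fin powR_ge0.
rewrite (ge0_integralD _ measurableT (p0 f a) _ (p0 g b)); last 2 first.
- exact: measurable_moment.
- exact: measurable_moment.
exact: lte_add_pinfty ffin gfin.
Qed.

Lemma finite_moment_sum (I : Type) (r : seq I) (f : I -> T -> R) :
  (forall i, measurable_fun setT (f i)) -> (forall i t, 0 <= f i t) ->
  (forall i, finite_moment P (f i)) ->
  finite_moment P (fun t => \sum_(i <- r) f i t).
Proof.
move=> mf f0 ffin; elim: r => [|i r IH].
  exists 1; split=> //; under eq_integral do rewrite big_nil addr0 powR1.
  rewrite integral_cst // mul1e.
  exact: le_lt_trans (probability_le1 P measurableT) (ltry 1).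
rewrite (_ : (fun t => _) = fun t => f i t + \sum_(j <- r) f j t); last first.
  by apply/funext => t; rewrite big_cons.
apply: finite_momentD (mf i) _ (f0 i) _ (ffin i) IH.
  exact: measurable_sum.
by move=> t; rewrite sumr_ge0.
Qed.

(* Markov's inequality for [(1 + f) `^ theta]. *)
Lemma light_tailed_le_ln (X f : T -> R) (a k : R) :
  measurable_fun setT f -> (forall t, 0 <= f t) -> finite_moment P f ->
  0 < a -> 0 <= k ->
  (forall x, measurable [set t | x < X t]) ->
  (forall t, X t <= a * ln (1 + k * f t)) ->
  light_tailed P X.
Proof.
move=> mf f0 ffin a0 k0 mX Xle.
have kf0 t : 0 <= k * f t by rewrite mulr_ge0.
have mkf : measurable_fun setT (fun t => k * f t) by exact: measurable_funM.
have [theta [theta0 kffin]] := finite_momentZ mf f0 k0 ffin.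
(* If [x < X t], then [x <= a * ln (1 + k * f t)], so [expR (theta / a * x)] is at most the
   [theta]-th power of [1 + k * f t]. The constant [K] is the moment itself. *)
exists (theta / a); split; first by rewrite divr_gt0.
set I := (\int[P]_t _)%E in kffin.
have I0 : (0 <= I)%E by apply: integral_ge0 => t _; rewrite lee_fin powR_ge0.
have IE : I = (fine I)%:E by rewrite fineK // ge0_fin_numE.
exists (fine I), 0 => x _; set A := [set t | x < X t].
have key : ((expR (theta / a * x))%:E * P A <= I)%E.
  have -> : P A = (\int[P]_t (\1_A t)%:E)%E.
    by rewrite integral_indic ?setIT //; exact: mX.
  have mA1 : measurable_fun setT (fun t => (\1_A t : R)%:E).
    by apply/measurable_EFinP; apply: measurable_indic; exact: mX.
  have A0 t : setT t -> (0 <= (\1_A t : R)%:E)%E by rewrite lee_fin.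
  rewrite -(ge0_integralZl_EFin P measurableT A0 mA1) ?expR_ge0 //.
  apply: ge0_le_integral_setT => t.
    by rewrite -EFinM lee_fin mulr_ge0 ?expR_ge0.
  rewrite -EFinM lee_fin indicE; case: (boolP (t \in A)) => tA.
    rewrite mulr1 /powR gt_eqF ?ltr_pwDl // ler_expR -mulrA ler_pM2l //.
    rewrite mulrC ler_pdivrMr // mulrC.
    by move: tA; rewrite inE /A /= => /ltW xX; exact: le_trans xX (Xle t).
  by rewrite mulr0 powR_ge0.
rewrite expRN mulrC EFinM -IE lee_pdivlMl ?expR_gt0 //.
Qed.

End MomentsAndTails.

(** * Bounds and measurability of the capacities *)

Section Capacity.
Variable R : realType.
Local Notation C := (complex R).

Lemma ln2_gt0 : 0 < ln 2 :> R.
Proof. by rewrite ln_gt0 // ltr1n. Qed.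

(** The shape shared by both capacities: [M] is a Gram matrix in one and is built from a covariance
    matrix in the other. *)
Definition logdet n (c : R) (M : 'M[C]_n) : R :=
  log2 (complex.Re (\det (1%:M + (c%:C)%C *: M))).

Lemma logdet_le n (M : 'M[C]_n) (c s : R) : psd M -> 0 <= c ->
  complex.Re (\tr M) <= s -> logdet c M <= n%:R / ln 2 * ln (1 + c * s).
Proof.
move=> Mpsd c0 trs; have /andP[det1 detle] := psd_det1D Mpsd c0.
have [tr0 _] := psd_lambda_max Mpsd.
have {}tr0 : 0 <= complex.Re (\tr M) by case/andP: tr0; exact: le_trans.
have b0 : 0 < 1 + c * complex.Re (\tr M) by rewrite ltr_pwDl ?mulr_ge0.
have bs : 1 + c * complex.Re (\tr M) <= 1 + c * s.
  by rewrite lerD2l ler_wpM2l.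
rewrite /logdet /log2 mulrAC ler_pM2r ?invr_gt0 ?ln2_gt0 //.
apply: le_trans (_ : n%:R * ln (1 + c * complex.Re (\tr M)) <= _).
  rewrite mulr_natl -lnXn // ler_ln ?posrE ?exprn_gt0 //.
  exact: lt_le_trans ltr01 det1.
by rewrite ler_wpM2l // ler_ln ?posrE // (lt_le_trans b0 bs).
Qed.

Variables (N NR NT : nat) (W rho : R).
Hypotheses (N0 : (0 < N)%N) (W0 : 0 < W) (rho0 : 0 < rho).
Local Notation c := (rho / NT%:R).

Let c0 : 0 <= c. Proof. by rewrite divr_ge0 // ltW. Qed.
Let WN0 : 0 < W / N%:R. Proof. by rewrite divr_gt0 // ltr0n. Qed.

Lemma cap_unknown_le (H : 'I_N -> 'M[C]_(NR, NT)) :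
  cap_unknown W rho H <= W * NR%:R / ln 2 * ln (1 + c * \sum_i sqnorm (H i)).
Proof.
(* Every summand is bounded through the total over all sub-channels, so the [N] equal bounds cancel
   the factor [1 / N]. *)
have -> : W * NR%:R / ln 2 * ln (1 + c * \sum_i sqnorm (H i)) =
    W / N%:R * \sum_(i < N) (NR%:R / ln 2 * ln (1 + c * \sum_i sqnorm (H i))).
  by rewrite sumr_const card_ord -[X in _ = _ * X]mulr_natl !mulrA divfK
     ?pnatr_eq0 -?lt0n.
rewrite ler_pM2l //; apply: ler_sum => i _; apply: logdet_le => //.
  exact: psd_gram.
rewrite mxtrace_mulctr /= (bigD1 i) //= lerDl sumr_ge0 // => j _.
exact: sqnorm_ge0.
Qed.

Definition feasible : set 'M[C]_(\sum_(i < N) NT) :=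
  [set Rm | psd Rm /\ \tr Rm = (NT * N)%:R].

(** Uniform power allocation meets the trace constraint exactly; it keeps the set under the supremum
    nonempty. *)
Lemma feasible1 : feasible 1%:M.
Proof.
by split; [exact: psd1 | rewrite mxtrace1 sum_nat_const card_ord mulnC].
Qed.

Definition rate (H : 'I_N -> 'M[C]_(NR, NT)) (Rm : 'M[C]_(\sum_(i < N) NT)) : R :=
  logdet c (blkdiag H *m Rm *m ctr (blkdiag H)).

Lemma rate_le H Rm : feasible Rm ->
  W / N%:R * rate H Rm <=
    W * NR%:R / ln 2 * ln (1 + c * (NT * N)%:R * \sum_i sqnorm (H i)).
Proof.
move=> [Rpsd Rtr].
(* The determinant has size [N * NR], whose factor [N] cancels the [1 / N]. *)
have -> : W * NR%:R / ln 2 * ln (1 + c * (NT * N)%:R * \sum_i sqnorm (H i)) =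
    W / N%:R * ((\sum_(i < N) NR)%:R / ln 2 *
      ln (1 + c * ((NT * N)%:R * \sum_i sqnorm (H i)))).
  have nN : N%:R != 0 :> R by rewrite pnatr_eq0 -lt0n.
  by rewrite sum_nat_const card_ord (natrM R N NR) !mulrA (divfK nN).
rewrite ler_pM2l //; apply: logdet_le => //; first exact: psd_mulctr.
have /andP[_] := psd_mxtrace_mulctr (blkdiag H) Rpsd.
by rewrite Rtr sqnorm_blkdiag raddfMn.
Qed.

(** Eliminates the supremum, both for the upper bound and for measurability. The set is nonempty by
    [feasible1] and bounded by [rate_le]. *)
Lemma cap_known_gtP (H : 'I_N -> 'M[C]_(NR, NT)) x : x < cap_known W rho H <->
  exists2 Rm, feasible Rm & x < W / N%:R * rate H Rm.
Proof.
rewrite /cap_known; set E := [set y : R | _].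
have EP Rm : feasible Rm -> E (rate H Rm) by move=> [? ?]; exists Rm.
have E0 : E !=set0 by exists (rate H 1%:M); exact: EP feasible1.
split=> [|[Rm Rf xlt]].
  rewrite -ltr_pdivrMl // => /(sup_gt E0)[_ [Rm [Rpsd Rtr ->]]].
  by rewrite ltr_pdivrMl // => xlt; exists Rm.
apply: lt_le_trans xlt _; rewrite ler_pM2l //; apply: ub_le_sup (EP _ Rf).
exists ((W * NR%:R / ln 2 *
  ln (1 + c * (NT * N)%:R * \sum_i sqnorm (H i))) / (W / N%:R)).
move=> _ [Rm' [Rpsd Rtr ->]]; rewrite ler_pdivlMr // mulrC.
by apply: rate_le; split.
Qed.

Lemma cap_known_le (H : 'I_N -> 'M[C]_(NR, NT)) : cap_known W rho H <=
  W * NR%:R / ln 2 * ln (1 + c * (NT * N)%:R * \sum_i sqnorm (H i)).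
Proof.
rewrite leNgt; apply/negP => /cap_known_gtP[Rm Rf].
by rewrite ltNge rate_le.
Qed.

(** Real parts in the left half and imaginary parts in the right half, so that rational
    approximation and continuity are handled on real matrices. *)
Definition complexify m n (A : 'M[R]_(m, n + n)) : 'M[C]_(m, n) :=
  \matrix_(i, j) (A i (lshift n j) +i* A i (rshift n j))%C.

Lemma complexify_surj m n (B : 'M[C]_(m, n)) : exists A, complexify A = B.
Proof.
exists (row_mx (\matrix_(i, j) complex.Re (B i j))
               (\matrix_(i, j) complex.Im (B i j))).
by apply/matrixP => i j; rewrite mxE row_mxEl row_mxEr !mxE; case: (B i j).
Qed.

Lemma continuous_rate H A : feasible (complexify A) ->
  {for A, continuous (fun A => W / N%:R * rate H (complexify A))}.
Proof.
move=> [Apsd _].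
pose S (f : 'M[R]_(\sum_(i < N) NT, \sum_(i < N) NT + \sum_(i < N) NT) -> R) :=
  continuous f.
have S_cst a : S (fun=> a) by move=> x; exact: cst_continuous.
have S_add f g : S f -> S g -> S (fun x => f x + g x).
  by move=> Sf Sg x; exact: cvgD (Sf x) (Sg x).
have S_mul f g : S f -> S g -> S (fun x => f x * g x).
  by move=> Sf Sg x; exact: cvgM (Sf x) (Sg x).
have Sc : regmx S (@complexify _ _).
  by move=> i j; split=> /=; under eq_fun do rewrite mxE /=;
     exact: coord_continuous.
have [+ _] : regc S (fun A => \det (1%:M + (c%:C)%C *:
    (blkdiag H *m complexify A *m ctr (blkdiag H)))).
  apply: (regc_det S_cst S_add S_mul); apply: (regmx_add S_add).
    exact: (regmx_cst S_cst).
  apply: (regmx_scale S_cst S_add S_mul).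
  apply: (regmx_mul S_cst S_add S_mul); last exact: (regmx_cst S_cst).
  by apply: (regmx_mul S_cst S_add S_mul) Sc; exact: (regmx_cst S_cst).
move=> /(_ A) dcont.
(* Feasibility makes the determinant at least [1] at [A], where [ln] is therefore continuous. *)
have /andP[d1 _] := psd_det1D (psd_mulctr (blkdiag H) Apsd) c0.
have lndet := continuous_comp dcont (continuous_ln (lt_le_trans ltr01 d1)).
exact: (cvgM (cvg_cst (W / N%:R)) (cvgM lndet (cvg_cst (ln 2)^-1))).
Qed.

End Capacity.

Section CapacityMeasurable.
Context d (T : measurableType d) (R : realType) (N NR NT : nat) (W rho : R).
Variable H : 'I_N -> T -> 'M[complex R]_(NR, NT).
Hypotheses (N0 : (0 < N)%N) (W0 : 0 < W) (rho0 : 0 < rho).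

Let S (f : T -> R) := measurable_fun setT f.
Hypothesis mH : forall i, regmx S (H i).

Let S_cst (a : R) : S (fun=> a). Proof. exact: measurable_cst. Qed.
Let S_add f g : S f -> S g -> S (fun x => f x + g x).
Proof. exact: measurable_funD. Qed.
Let S_mul f g : S f -> S g -> S (fun x => f x * g x).
Proof. exact: measurable_funM. Qed.

Lemma measurable_sqnorm i : measurable_fun setT (fun t => sqnorm (H i t)).
Proof. exact: (reg_sqnorm S_cst S_add S_mul). Qed.

Lemma measurable_logdet n (c : R) (M : T -> 'M[complex R]_n) :
  regmx S M -> measurable_fun setT (fun t => logdet c (M t)).
Proof.
move=> SM; apply: measurable_funM; last exact: measurable_cst.
apply: (measurableT_comp (@measurable_ln R)).
have [] := regc_det S_cst S_add S_mul (A := fun t => 1%:M + (c%:C)%C *: M t);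
  last by [].
apply: (regmx_add S_add); first exact: (regmx_cst S_cst).
exact: (regmx_scale S_cst S_add S_mul).
Qed.

Lemma measurable_rate Rm : measurable_fun setT (fun t => rate rho (H ^~ t) Rm).
Proof.
have SB : regmx S (fun t => blkdiag (H ^~ t)) by exact: (regmx_blkdiag S_cst).
apply: measurable_logdet.
apply: (regmx_mul S_cst S_add S_mul); last exact: (regmx_ctr S_cst S_mul).
by apply: (regmx_mul S_cst S_add S_mul) => //; exact: (regmx_cst S_cst).
Qed.

Lemma measurable_cap_unknown :
  measurable_fun setT (fun t => cap_unknown W rho (H ^~ t)).
Proof.
apply: measurable_funM; first exact: measurable_cst.
apply: measurable_sum => i; apply: measurable_logdet.
by apply: (regmx_mul S_cst S_add S_mul (mH i)); exact: (regmx_ctr S_cst S_mul).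
Qed.

(* The supremum over the uncountable feasible set is reduced to a countable
   dense subset by continuity of the rate in the covariance matrix. *)
Lemma measurable_cap_known_gt x :
  measurable [set t | x < cap_known W rho (H ^~ t)].
Proof.
pose D := [set A | feasible (N := N) (NT := NT) (complexify (R := R) A)].
have [u [Du uP]] : exists u : nat -> _, (forall k, D (u k)) /\
    forall A O, D A -> nbhs A O -> exists k, O (u k).
  apply: countable_dense_subset.
  have [A AE] := complexify_surj (1%:M : 'M[complex R]_(\sum_(i < N) NT)).
  by exists A; rewrite /D /= AE; exact: feasible1.
have -> : [set t | x < cap_known W rho (H ^~ t)] =
    \bigcup_k [set t | x < W / N%:R * rate rho (H ^~ t) (complexify (u k))].
  apply/seteqP; split=> [t|t [k _] xlt] /=; last first.
    by apply/cap_known_gtP => //; exists (complexify (u k)) => //; exact: Du.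
  move=> /(cap_known_gtP N0 W0 rho0)[Rm]; have [A <-] := complexify_surj Rm.
  move=> Af xlt.
  (* By continuity the strict inequality persists on a neighbourhood of [A], which contains some
     [u k]. *)
  have rc := continuous_rate (W := W) rho0 (H := H ^~ t) Af.
  have [k xk] := uP A _ Af (cvgr_gt _ rc _ xlt).
  by exists k.
apply: bigcupT_measurable => k; rewrite -[X in measurable X]setTI.
rewrite -preimage_itvoy.
have mr : measurable_fun setT
    (fun t => W / N%:R * rate rho (H ^~ t) (complexify (u k))).
  by apply: measurable_funM; [exact: measurable_cst | exact: measurable_rate].
by apply: mr => //; exact: measurable_itv.
Qed.

End CapacityMeasurable.

(** * Equivalence of the moment conditions, and the tails of both capacities *)

Unset Implicit Arguments.

Theorem theorem2 (R : realType) (d : measure_display) (T : measurableType d)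
  (P : probability T R) (N NR NT : nat) (W rho : R)
  (H : 'I_N -> T -> 'M[complex R]_(NR, NT)) :
  (0 < N)%N -> (0 < NR)%N -> (0 < NT)%N -> 0 < W -> 0 < rho ->
  (forall (i : 'I_N) (a : 'I_NR) (b : 'I_NT),
      measurable_fun setT (fun t => complex.Re (H i t a b)) /\
      measurable_fun setT (fun t => complex.Im (H i t a b))) ->
  let lam_i (i : 'I_N) (t : T) := lambda_max (H i t *m ctr (H i t)) in
  let lam (t : T) := lambda_max (blkdiag (H ^~ t) *m ctr (blkdiag (H ^~ t))) in
  ((forall i : 'I_N, finite_moment P (lam_i i)) <-> finite_moment P lam) /\
  ((forall i : 'I_N, finite_moment P (lam_i i)) \/ finite_moment P lam ->
     light_tailed P (fun t => cap_known W rho (H ^~ t)) /\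
     light_tailed P (fun t => cap_unknown W rho (H ^~ t))).
Proof.
move=> N0 NR0 _ W0 rho0 mH lam_i lam.
have reg i : regmx (fun f : T -> R => measurable_fun setT f) (H i).
  by move=> a b; exact: mH.
pose s i t := sqnorm (H i t); pose S t := \sum_i s i t.
have s0 i t : 0 <= s i t by exact: sqnorm_ge0.
have ms i : measurable_fun setT (s i) by exact: measurable_sqnorm.
have mS : measurable_fun setT S by exact: measurable_sum.
have S0 t : 0 <= S t by rewrite sumr_ge0.
have lam_iP i t : 0 <= lam_i i t <= s i t /\ s i t <= NR%:R * lam_i i t.
  exact: lambda_max_gram.
have lamP t : 0 <= lam t <= S t /\ S t <= (\sum_(i < N) NR)%:R * lam t.
  by have := lambda_max_gram (blkdiag (H ^~ t)); rewrite sqnorm_blkdiag.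
(* One direction is monotonicity; the other uses the reverse comparison up to the positive factor
   [NR]. *)
have mom_i i : finite_moment P (lam_i i) <-> finite_moment P (s i).
  split; last by apply: le_finite_moment => t; have [] := lam_iP i t.
  apply: (finite_moment_dominated (k := NR%:R)) => //; first by rewrite ltr0n.
  by move=> t; rewrite s0; have [] := lam_iP i t.
have mom : finite_moment P lam <-> finite_moment P S.
  split; last by apply: le_finite_moment => t; have [] := lamP t.
  apply: (finite_moment_dominated (k := (\sum_(i < N) NR)%:R)) => //.
    by rewrite ltr0n sum_nat_const card_ord muln_gt0 N0.
  by move=> t; rewrite S0; have [] := lamP t.
(* A finite sum keeps finite moments, and conversely each [s i] lies below [S]. *)
have moms : (forall i, finite_moment P (s i)) <-> finite_moment P S.
  split=> [sfin|Sfin i]; first exact: finite_moment_sum.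
  apply: le_finite_moment Sfin => t.
  by rewrite s0 /S (bigD1 i) //= lerDl sumr_ge0.
have iff_lam : (forall i, finite_moment P (lam_i i)) <-> finite_moment P lam.
  split=> [h|/mom/moms h i]; last exact/mom_i.
  by apply/mom/moms => i; exact/mom_i.
split=> // hyp.
have Sfin : finite_moment P S by apply/mom; case: hyp => // /iff_lam.
have a0 : 0 < W * NR%:R / ln 2 by rewrite divr_gt0 ?ln2_gt0 ?mulr_gt0 ?ltr0n.
have c0 : 0 <= rho / NT%:R by rewrite divr_ge0 // ltW.
split.
  (* The factor [NT * N] in [k] is the prescribed trace of the covariance matrix. *)
  apply: (light_tailed_le_ln (k := rho / NT%:R * (NT * N)%:R) mS S0 Sfin a0).
  - by rewrite mulr_ge0.
  - by move=> x; exact: measurable_cap_known_gt.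
  - by move=> t; exact: cap_known_le.
apply: (light_tailed_le_ln mS S0 Sfin a0 c0).
- move=> x; rewrite -[X in measurable X]setTI -preimage_itvoy.
  by apply: measurable_cap_unknown => //; exact: measurable_itv.
- by move=> t; exact: cap_unknown_le.
Qed.
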